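(* The tempered fractional derivative $D^{\sigma,\alpha}_{0,t}u(t)$ of order $\alpha>0$ (with $\sigma\ge 0$) is equivalent to the following Hadamard finite-part integral: $$D^{\sigma,\alpha}_{0,t}u(t)=\frac{1}{\Gamma(-\alpha)}\,P.V.\int_{0}^{t}(t-s)^{-\alpha-1}e^{-\sigma(t-s)}u(s)\,ds .$$
   Context: Tempered fractional integral: for order $\alpha\ge 0$ and $\sigma\ge 0$, $$I^{\sigma,\alpha}_{0,t}u(t)=\frac{1}{\Gamma(\alpha)}\int_0^t(t-s)^{\alpha-1}e^{-\sigma(t-s)}u(s)\,ds,$$ where $\Gamma$ is the Gamma function. Tempered fractional derivative: for order $\alpha>0$, $\sigma\ge 0$ and the positive integer $m$ with $m-1<\alpha\le m$, $$D^{\sigma,\alpha}_{0,t}u(t)=(\partial_t+\sigma)^m I^{\sigma,m-\alpha}_{0,t}u(t)=(\partial_t+\sigma)^m\left[\frac{1}{\Gamma(m-\alpha)}\int_0^t (t-s)^{m-\alpha-1}e^{-\sigma(t-s)}u(s)\,ds\right],$$ where $(\partial_t+\sigma)^m=\sum_{k=0}^m\binom{m}{k}\sigma^{m-k}\partial_t^k$. Hadamard finite-part integral: let $f(x)$ be integrable on $(\epsilon,A)$ for any $A>0$ and $0<\epsilon<A$. The function $f$ is said to possess the Hadamard property at the point $x=0$ if there exist constants $a_k$, $b_0$ and $\lambda_k>0$ ($k=1,\dots,N$) such that $$\int_\epsilon^A f(x)\,dx=\sum_{k=1}^N a_k\epsilon^{-\lambda_k}+b_0\ln\frac1\epsilon+J_0(\epsilon),$$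 where $\lim_{\epsilon\to0}J_0(\epsilon)$ exists and is finite; this limit is denoted by $P.V.\int_0^A f(x)\,dx=\lim_{\epsilon\to0}J_0(\epsilon)$. In the integral of the claim the singular point is $s=t$, which corresponds to $x=0$ under $x=t-s$.
   Formalization: The order α is assumed not to be an integer, since Γ(−α) has a pole there and the formula is undefined; and u, for which no regularity is stated, is assumed integrable on [0,t] and of class C^m near t, with t > 0, so that both sides exist. *)

(* Defs.v *)
From HB Require Import structures.
From mathcomp Require Export all_boot all_order all_algebra.
From mathcomp Require Export all_classical all_reals all_analysis.
Export Order.TTheory GRing.Theory Num.Theory.
Export numFieldNormedType.Exports.

Set Implicit Arguments.
Unset Strict Implicit.
Unset Printing Implicit Defensive.

Local Open Scope ring_scope.
Local Open Scope classical_set_scope.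

(* Euler integral; meaningful for 0 < x. *)
Definition euler_gamma (R : realType) (x : R) : R :=
  \int[lebesgue_measure]_(s in `]0, +oo[) (s `^ (x - 1) * expR (- s)).

(* Gamma on R minus {0, -1, -2, ...}, continued to x < 0 by
   Gamma x = Gamma (x + n) / (x (x + 1) ... (x + n - 1))
   with n = trunc |x| + 1, so that x + n > 0.  At the poles the denominator
   vanishes and the value is the junk value 0. *)
Definition Gamma (R : realType) (x : R) : R :=
  if 0 < x then euler_gamma x
  else let n := (Num.truncn `|x|).+1 in
       euler_gamma (x + n%:R) / \prod_(i < n) (x + i%:R).

(* For alpha = 0 the formula is formal (1 / Gamma 0 times a divergent
   integral); the definition is meaningful for 0 < alpha. *)
Definition tempered_int (R : realType) (sigma alpha : R) (u : R -> R) (t : R)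
    : R :=
  (Gamma alpha)^-1 *
  \int[lebesgue_measure]_(s in `[0, t])
     ((t - s) `^ (alpha - 1) * expR (- (sigma * (t - s))) * u s).

(* (d/dt + sigma)^m *)
Definition shifted_deriv (R : realType) (sigma : R) (m : nat) (f : R -> R)
    (t : R) : R :=
  \sum_(k < m.+1) 'C(m, k)%:R * sigma ^+ (m - k) * f^`(k)%classic t.

(* To be used with the positive integer m such that m - 1 < alpha <= m. *)
Definition tempered_deriv (R : realType) (m : nat) (sigma alpha : R)
    (u : R -> R) (t : R) : R :=
  shifted_deriv sigma m (tempered_int sigma (m%:R - alpha) u) t.

(* f is m times differentiable on a neighbourhood of t.  The operation derive1n
   is total, hence the need to state differentiability separately. *)
Definition derivable_upto (R : realType) (m : nat) (f : R -> R) (t : R) : Prop :=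
  \forall s \near t, forall k, (k < m)%N -> derivable f^`(k)%classic s 1.

Definition Cm_near (R : realType) (m : nat) (f : R -> R) (t : R) : Prop :=
  derivable_upto m f t /\ \forall s \near t, {for s, continuous f^`(m)%classic}.

(* The finite part of the integral of f over (0, A), with singular point 0,
   is l. *)
Definition is_finite_part (R : realType) (f : R -> R) (A l : R) : Prop :=
  (forall eps : R, 0 < eps < A ->
     lebesgue_measure.-integrable `[eps, A] (EFin \o f)) /\
  exists (N : nat) (a lambda : 'I_N -> R) (b0 : R) (J0 : R -> R),
    [/\ forall k, 0 < lambda k,
        forall eps : R, 0 < eps < A ->
          \int[lebesgue_measure]_(x in `[eps, A]) f x =
          \sum_(k < N) a k * eps `^ (- lambda k) + b0 * ln (1 / eps) + J0 eps
      & J0 eps @[eps --> 0^'+] --> l].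

Definition has_Hadamard (R : realType) (f : R -> R) (A : R) : Prop :=
  exists l, is_finite_part f A l.

(* P.V. int_0^A f(x) dx (0 when f lacks the Hadamard property) *)
Definition finite_part (R : realType) (f : R -> R) (A : R) : R :=
  xget 0 [set l | is_finite_part f A l].

Definition hypersing_integrand (R : realType) (sigma alpha : R) (u : R -> R)
    (t s : R) : R :=
  (t - s) `^ (- alpha - 1) * expR (- (sigma * (t - s))) * u s.

(* Main.v *)
From HB Require Import structures.
Require Import Defs.
From mathcomp Require Import measurable_realfun ring lra zify.
Local Open Scope ring_scope.
Local Open Scope classical_set_scope.

(** Put p = m - alpha, so that 0 < p < 1 because alpha is not an integer, and
    v(r) = e^(sigma r) u(r).  Multiplication by e^(sigma s) turns d/ds + sigma
    into d/ds, so the claim is about the m-th derivative of the untempered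
    convolution G(s) = int_0^s (s - r)^(p - 1) v(r) dr at s = t.

    Cut the convolution at distance e from its singular point:
      G(s) = int_0^e x^(p - 1) v(s - x) dx + Q_(p - 1)(s),
      Q_q(s) = int_0^(s - e) (s - r)^q v(r) dr.
    The near part has a fixed domain, and differentiating it under the integral
    sign lets the derivatives fall on v, which is smooth near t
    (is_derive_singular_conv).  The far part has a smooth kernel but a v that is
    merely integrable; Leibniz's rule gives
      Q_q' (s) = q Q_(q - 1)(s) + e^q v(s - e)
    (is_derive_truncated_conv).  After m steps (conv_tower_derivative),
      G^(m)(t) = int_0^e x^(p - 1) v^(m)(t - x) dx
                 + sum_(i < m) c_i e^(p - 1 - i) v^(m - 1 - i)(t - e)
                 + c_m Q_(p - 1 - m)(t),      c_k = (p - 1) ... (p - k).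
    This is an identity in e, and Q_(p - 1 - m)(t), seen from t, is the integral
    of x^(- alpha - 1) v(t - x) over [e, t].  When e tends to 0 the first term
    vanishes, and Taylor's formula turns the sum into a combination of the
    negative powers e^(p - 1 - i), i < m, plus O(e^p).  Hence the finite part is
    G^(m)(t) / c_m (power_conv_finite_part).  It is well defined because negative
    powers and logarithms cannot add up to a nonzero limit
    (is_finite_part_unique).  Finally the continuation of Gamma to - alpha is
    Gamma(p) / c_m by definition (Gamma_opp), and the factors c_m cancel. *)

Set Implicit Arguments.
Unset Strict Implicit.
Unset Printing Implicit Defensive.

(** * Successive derivatives on a neighbourhood *)

Section calculus.
Context {R : realType}.
Implicit Types (f w : R -> R) (g : nat -> R -> R) (t d s c e : R).

(** Explicit candidates for the successive derivatives on an open ball.  The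
    iterated derivative is total and carries no differentiability; a tower
    carries it, and can be built term by term. *)
Definition derivative_tower (n : nat) (g : nat -> R -> R) t d : Prop :=
  forall k s, (k < n)%N -> `|s - t| < d -> is_derive s 1 (g k) (g k.+1 s).

Lemma is_derive_continuous f (x df : R) : is_derive x 1 f df -> {for x, continuous f}.
Proof.
by case=> fx _; apply: differentiable_continuous; exact/derivable1_diffP.
Qed.

Lemma is_derive_subl (s x : R) : is_derive s 1 (fun y => y - x) 1.
Proof.
have := @is_deriveB _ _ _ id (cst x) s 1 _ _ (is_derive_id _ _)
  (is_derive_cst _ _ _).
by move=> H; apply: (is_derive_eq H); rewrite subr0.
Qed.

Lemma is_derive_subr (s x : R) : is_derive x 1 (fun y => s - y) (- 1).
Proof.
have := @is_deriveB _ _ _ (cst s) id x 1 _ _ (is_derive_cst _ _ _)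
  (is_derive_id _ _).
by move=> H; apply: (is_derive_eq H); rewrite sub0r.
Qed.

Lemma is_derive_scale (f : R -> R) (c s df : R) : is_derive s 1 f df ->
  is_derive s 1 (fun x => c * f x) (c * df).
Proof. exact: is_deriveZ. Qed.

Lemma dist_lt_near t d s : `|s - t| < d -> \forall x \near s, `|x - t| < d.
Proof.
move=> sd; have d0 : 0 < d - `|s - t| by rewrite subr_gt0.
near=> x; rewrite (_ : x - t = (x - s) + (s - t)); last by ring.
apply: le_lt_trans (ler_normD _ _) _; rewrite -ltrBrDr distrC.
by near: x; apply: (nbhsx_ballx s _ d0).
Unshelve. all: by end_near. Qed.

Lemma nbhs_dist_lt t (P : set R) : (\forall s \near t, P s) ->
  exists2 d, 0 < d & forall s, `|s - t| < d -> P s.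
Proof.
move=> /nbhs_ballP[d /= d0 dP]; exists d => // s sd.
by apply: dP; rewrite /ball/= distrC.
Qed.

(** The hypothesis on f is only local, so that a function given by an integral can
    be compared with a tower that exists near t only. *)
Lemma tower_derive1n n g f t d : derivative_tower n g t d ->
  (forall s, `|s - t| < d -> f s = g 0 s) ->
  forall k s, (k <= n)%N -> `|s - t| < d -> f^`(k)%classic s = g k s.
Proof.
move=> gT fg; elim=> [|k IH] s kn sd; first exact: fg.
rewrite derive1nS derive1E; have gk := gT _ _ kn sd.
rewrite -[RHS]derive_val; apply: near_eq_derive.
near=> x; apply: IH; first exact: ltnW.
by near: x; exact: dist_lt_near.
Unshelve. all: by end_near. Qed.

Lemma tower_derive1n_tower n g f t d : derivative_tower n g t d ->
  (forall s, `|s - t| < d -> f s = g 0 s) ->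
  derivative_tower n (fun k => f^`(k)%classic) t d.
Proof.
move=> gT fg k s kn sd; have fE := tower_derive1n gT fg.
rewrite (fE k.+1)//; apply: near_eq_is_derive (gT _ _ kn sd).
have nd := dist_lt_near sd; near=> x.
have xd : `|x - t| < d by near: x.
by rewrite fE// ltnW.
Unshelve. all: by end_near. Qed.

Lemma tower_derivable n f t d : 0 < d ->
  derivative_tower n (fun k => f^`(k)%classic) t d -> derivable_upto n f t.
Proof.
move=> d0 fT; near=> s => k kn.
have sd : `|s - t| < d by near: s; apply: dist_lt_near; rewrite subrr normr0.
by have [] := fT k s kn sd.
Unshelve. all: by end_near. Qed.

Lemma Cm_near_tower n f t : Cm_near n f t -> exists2 d, 0 < d &
  derivative_tower n (fun k => f^`(k)%classic) t d /\
  forall k s, (k <= n)%N -> `|s - t| < d -> {for s, continuous f^`(k)%classic}.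
Proof.
move=> [fD fC].
have [d1 d10 HD] := nbhs_dist_lt fD; have [d2 d20 HC] := nbhs_dist_lt fC.
pose d := Num.min d1 d2.
have d0 : 0 < d by rewrite lt_min d10.
have H s : `|s - t| < d -> (forall k, (k < n)%N -> derivable f^`(k)%classic s 1) /\
    {for s, continuous f^`(n)%classic}.
  by rewrite lt_min => /andP[s1 s2]; split; [exact: HD|exact: HC].
exists d => //; split=> [k s kn sd|k s].
  have [/(_ _ kn) fk _] := H _ sd.
  by rewrite derive1nS derive1E; exact/derivableP.
rewrite leq_eqVlt => /predU1P[->|kn] sd; have [Hd Hc] := H _ sd => //.
by apply: differentiable_continuous; apply/derivable1_diffP/Hd.
Qed.

Lemma sum_ord_fctE n (h : 'I_n -> R -> R) :
  \sum_(i < n) h i = (fun x => \sum_(i < n) h i x).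
Proof. by apply/funext => x; rewrite fct_sumE. Qed.

Lemma is_derive_expM c (s : R) : is_derive s 1 (fun x => expR (c * x)) (c * expR (c * s)).
Proof.
have h : is_derive s 1 (fun x => c * x) c.
  have := @is_deriveZ _ _ _ id c s 1 1 _.
  move/(_ (is_derive_id _ _)); by rewrite [c *: 1]mulr1.
by rewrite mulrC; exact: (@is_derive1_comp _ expR _ s _ _ _ h).
Qed.

(** Leibniz's formula for the n-th derivative of s |-> e^(c s) g_0(s); its second
    factor is (d/ds + c)^n applied to g_0. *)
Definition exp_tower c g n s :=
  expR (c * s) * \sum_(k < n.+1) 'C(n, k)%:R * c ^+ (n - k) * g k s.

(** (d/ds + c)^(n + 1) is c (d/ds + c)^n plus the derivative of (d/ds + c)^n; on
    coefficients this is Pascal's rule. *)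
Lemma exp_tower_step c (a : nat -> R) n :
  c * (\sum_(k < n.+1) 'C(n, k)%:R * c ^+ (n - k) * a k)
  + \sum_(k < n.+1) 'C(n, k)%:R * c ^+ (n - k) * a k.+1
  = \sum_(k < n.+2) 'C(n.+1, k)%:R * c ^+ (n.+1 - k) * a k.
Proof.
rewrite [RHS]big_ord_recl/= bin0 subn0.
under [in RHS]eq_bigr => i _.
  rewrite /bump /= add1n binS natrD subSS mulrDl mulrDl.
  over.
rewrite big_split /= addrA; congr (_ + _).
rewrite mulr_sumr big_ord_recl /= bin0 subn0 exprS; congr (_ + _); first by ring.
rewrite [RHS]big_ord_recr /= (bin_small (ltnSn n)) !mul0r addr0.
apply: eq_bigr => i _; rewrite /bump /= add1n.
have -> : (n - i = (n - i.+1).+1)%N by have := ltn_ord i; lia.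
by rewrite exprS; ring.
Qed.

Lemma exp_tower_derivative c n g t d : derivative_tower n g t d ->
  derivative_tower n (exp_tower c g) t d.
Proof.
move=> gT k s kn sd; rewrite /exp_tower.
have h1 := is_derive_expM c s.
have h2 : is_derive s 1 (fun s => \sum_(i < k.+1) 'C(k, i)%:R * c ^+ (k - i) * g i s)
   (\sum_(i < k.+1) 'C(k, i)%:R * c ^+ (k - i) * g i.+1 s).
  rewrite -(sum_ord_fctE (fun (i : 'I_k.+1) s => 'C(k, i)%:R * c ^+ (k - i) * g i s)).
  apply: is_derive_sum => i.
  have gi : is_derive s 1 (g i) (g i.+1 s).
    by apply: gT => //; exact: leq_ltn_trans (leq_ord i) kn.
  exact: (@is_deriveZ _ _ _ (g i)).
have := @is_deriveM _ _ _ _ s 1 _ _ h1 h2; rewrite -(exp_tower_step c (g^~ s) k).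
move=> h; apply: (is_derive_eq h); rewrite /GRing.scale/=; ring.
Qed.

Lemma exp_tower0 c g s : exp_tower c g 0 s = expR (c * s) * g 0 s.
Proof. by rewrite /exp_tower big_ord1 bin0 subn0 expr0 !mul1r. Qed.

(** Taylor expansion to the left of t.  Only the existence of the coefficients
    matters, which makes the induction short: expand the derivative, integrate the
    coefficients, and bound the remainder by the mean value theorem. *)
Lemma taylor_left n g t d : 0 < d -> derivative_tower n g t d ->
  {for t, continuous (g n)} ->
  exists (a : nat -> R) C e, [/\ 0 <= C, 0 < e & forall x, 0 <= x < e ->
    `|g 0 (t - x) - \sum_(j < n) a j * x ^+ j| <= C * x ^+ n].
Proof.
move=> d0; elim: n g => [|n IH] g gT gc.
  have /cvgrPdist_lt/(_ 1 ltr01)/nbhs_dist_lt[e e0 He] := gc.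
  exists (fun=> 0), (`|g 0 t| + 1), e; split => // x /andP[x0 xe].
  rewrite big_ord0 subr0 expr0 mulr1 -lerBlDl.
  apply: le_trans (lerB_dist _ _) _.
  rewrite distrC; apply/ltW/He; rewrite addrAC subrr sub0r normrN ger0_norm//.
have [|//|a [C [e [C0 e0 He]]]] := IH (fun k => g k.+1).
  by move=> k s kn sd; exact: gT.
pose b j := if j is i.+1 then - a i / i.+1%:R else g 0 t.
exists b, C, (Num.min e d); split => //; first by rewrite lt_min e0.
move=> x /andP[x0]; rewrite lt_min => /andP[xe xd].
pose h y := g 0 (t - y) - \sum_(j < n.+1) b j * y ^+ j.
pose h' y := - (g 1 (t - y) - \sum_(j < n) a j * y ^+ j).
have hD y : 0 <= y <= x -> is_derive y 1 h (h' y).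
  move=> /andP[y0 yx].
  have g0D : is_derive y 1 (fun y => g 0 (t - y)) (- g 1 (t - y)).
    rewrite -mulrN1.
    apply: (@is_derive1_comp _ (g 0) _ y _ _ _ (is_derive_subr t y)).
    apply: gT => //; rewrite addrAC subrr sub0r normrN ger0_norm//.
    exact: le_lt_trans yx xd.
  have sD : is_derive y 1 (fun y => \sum_(j < n.+1) b j * y ^+ j)
      (- \sum_(j < n) a j * y ^+ j).
    rewrite -(sum_ord_fctE (fun (j : 'I_n.+1) y => b j * y ^+ j)).
    have : is_derive y 1 (\sum_(j < n.+1) (fun y => b j * y ^+ j))
        (\sum_(j < n.+1) b j * (j%:R * y ^+ j.-1)).
      apply: is_derive_sum => j.
      have jD := @is_deriveX _ _ id j y 1 _ (is_derive_id _ _).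
      have -> : (fun y => b j * y ^+ j) = b j *: (id : R -> R) ^+ j.
        by apply/funext => z; rewrite /= exprfctE.
      have := @is_deriveZ _ _ _ _ (b j) y 1 _ jD.
      by move=> H; apply: (is_derive_eq H); rewrite /GRing.scale/= mulr1 mulr_natl.
    move=> H; apply: (is_derive_eq H).
    rewrite big_ord_recl /= mul0r mulr0 add0r -sumrN; apply: eq_bigr => i _.
    by rewrite /bump /= add1n mulrA divfK ?pnatr_eq0// mulNr.
  have := @is_deriveB _ _ _ _ _ y 1 _ _ g0D sD.
  by move=> H; apply: (is_derive_eq H); rewrite /h'; ring.
have [y| |c cx] := @MVT_segment _ h h' 0 x x0.
- by rewrite in_itv/= => /andP[y0 yx]; apply: hD; rewrite !ltW.
- apply: derivable_within_continuous => y; rewrite in_itv/= => yx.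
  by have [] := hD _ yx.
have -> : h 0 = 0.
  rewrite /h big_ord_recl/= subr0 expr0 mulr1 big1 ?addr0 ?subrr// => i _.
  by rewrite /bump /= add1n exprS mul0r mulr0.
rewrite !subr0 => hx; rewrite [X in `|X|](_ : _ = h x)// hx normrM (ger0_norm x0).
move: cx; rewrite in_itv/= => /andP[c0 cx].
rewrite exprSr mulrA ler_wpM2r// /h' normrN.
apply: le_trans (He c _) _; first by rewrite c0 (le_lt_trans cx).
by rewrite ler_wpM2l// lerXn2r.
Qed.

End calculus.

(** * Lebesgue integrals over intervals: reflection, concatenation, powers *)

Section integrals.
Context {R : realType}.
Notation mu := (@lebesgue_measure R).

(** A map between two copies of the type that carries the Lebesgue measure, so
    that its push-forward of that measure is again a measure on that type. *)
Definition point_reflection (c : R) : measurableTypeR R -> measurableTypeR R :=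
  fun x => c - x.

Lemma preimage_reflect (c a b : R) :
  point_reflection c @^-1` `[c - b, c - a] = `[a, b].
Proof.
by apply/seteqP; split => x /=; rewrite !in_itv/= !lerD2l !lerN2 andbC.
Qed.

Lemma measurable_reflect c : measurable_fun setT (point_reflection c).
Proof. apply: measurable_funB => //. Qed.

(** The two measures agree on half-open intervals, which generate the Borel sets.
    Invariance of the measure covers all integrands, in particular those that are
    singular at an end point or merely integrable. *)
Lemma lebesgue_measure_reflect c (A : set R) : measurable A ->
  pushforward mu (point_reflection c) A = mu A.
Proof.
move=> mA; apply/esym/lebesgue_measure_unique => //=.
  exact: measurable_reflect.
move=> _ _ [[a b]] _ <-.
rewrite /pushforward.
have -> : point_reflection c @^-1` `]a, b] = `[c - b, c - a[.
  by apply/seteqP; split => x /=; rewrite !in_itv/= /point_reflection; lra.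
rewrite /= !lebesgue_measure_itv/= !lte_fin ltrD2l ltrN2.
by case: ifPn => // _; rewrite -!EFinD; congr (_%:E); ring.
Qed.

Lemma ge0_integral_reflect (c : R) (D : set R) (f : R -> \bar R) :
  measurable D -> measurable_fun D f -> {in D, forall y, 0 <= f y}%E ->
  (\int[mu]_(y in D) f y = \int[mu]_(x in point_reflection c @^-1` D) f (c - x)%R)%E.
Proof.
move=> mD mf f0.
rewrite -[RHS](ge0_integral_pushforward (measurable_reflect c) mu mD mf f0).
apply: eq_measure_integral => [|mr A mA AS]; first exact: measurable_reflect.
by rewrite [RHS]lebesgue_measure_reflect.
Qed.

Lemma integral_reflect (c : R) (D : set R) (f : R -> \bar R) :
  measurable D -> measurable_fun D f ->
  (\int[mu]_(y in D) f y = \int[mu]_(x in point_reflection c @^-1` D) f (c - x)%R)%E.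
Proof.
move=> mD mf; rewrite integralE [RHS]integralE.
rewrite !(ge0_integral_reflect c mD)//.
- by congr (_ - _)%E; apply: eq_integral => x _; rewrite ?funeposE ?funenegE.
- exact: measurable_funeneg.
- exact: measurable_funepos.
Qed.

Lemma integrable_reflect c (a b : R) (f : R -> R) :
  mu.-integrable `[c - b, c - a] (EFin \o f) ->
  mu.-integrable `[a, b] (EFin \o (fun x => f (c - x))).
Proof.
move=> /integrableP[mf fi]; apply/integrableP; split.
  apply: (measurable_comp _ _ mf (measurable_funS _ _ (measurable_reflect c))) => //.
  by rewrite -(preimage_reflect c); move=> _ [x + <-].
rewrite -(preimage_reflect c) -(ge0_integral_reflect c (f := fun y => `|(f y)%:E|%E))//.
exact: measurableT_comp.
Qed.

Lemma Rintegral_reflect c (a b : R) (f : R -> R) :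
  mu.-integrable `[c - b, c - a] (EFin \o f) ->
  \int[mu]_(y in `[c - b, c - a]) f y = \int[mu]_(x in `[a, b]) f (c - x).
Proof.
move=> /integrableP[mf fi]; rewrite /Rintegral; congr fine.
by rewrite -(preimage_reflect c a b); exact: integral_reflect.
Qed.

Lemma integrable_mul_bounded (D : set R) (f h : R -> R) M : measurable D ->
  measurable_fun D h -> (forall x, D x -> `|h x| <= M) ->
  mu.-integrable D (EFin \o f) ->
  mu.-integrable D (EFin \o (fun x => h x * f x)).
Proof.
move=> mD mh hM fi.
have hb : [bounded h x | x in D].
  exists M; split; first exact: num_real.
  by move=> N MN x Dx; exact: le_trans (hM _ Dx) (ltW MN).
by rewrite (_ : EFin \o _ = (EFin \o h) \* (EFin \o f))%E //; exact: integrableMr.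
Qed.

Lemma integrable_itv_cat (a b c : R) (f : R -> R) :
  mu.-integrable `[a, b] (EFin \o f) -> mu.-integrable `[b, c] (EFin \o f) ->
  mu.-integrable `[a, c] (EFin \o f).
Proof.
move=> i1 i2.
have sub : `[a, c] `<=` `[a, b] `|` (`[b, c] `\` `[a, b]).
  move=> x /=; rewrite !in_itv/= => /andP[ax xc]; rewrite ax/=.
  have [xb|bx] := leP x b; [by left|right].
  by rewrite (ltW bx) xc.
have i3 : mu.-integrable (`[b, c] `\` `[a, b]) (EFin \o f).
  by apply: integrableS i2 => //; exact: measurableD.
have m12 : measurable (`[a, b] `|` (`[b, c] `\` `[a, b]) : set R).
  by apply: measurableU => //; exact: measurableD.
suff i4 : mu.-integrable (`[a, b] `|` (`[b, c] `\` `[a, b])) (EFin \o f).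
  by apply: integrableS i4.
have [/integrableP[mf1 f1] /integrableP[mf3 f3]] := (i1, i3).
have mf : measurable_fun (`[a, b] `|` (`[b, c] `\` `[a, b]) : set R) (EFin \o f).
  by apply/measurable_funU => //; exact: measurableD.
apply/integrableP; split => //.
rewrite ge0_integral_setU//.
- by rewrite lte_add_pinfty.
- exact: measurableD.
- exact: measurableT_comp.
- apply/disj_setPS => x [/= h1 [_ h2]]; exact: h2.
Qed.

Lemma powR_continuous_at (p x : R) : 0 < x -> {for x, continuous (@powR R ^~ p)}.
Proof.
by move=> x0; exact: is_derive_continuous (is_derive1_powR p x0).
Qed.

Lemma Rintegral_powR (p a b : R) : p != 0 -> 0 < a < b ->
  (\int[mu]_(x in `[a, b]) (x `^ (p - 1))%:E = ((b `^ p - a `^ p) / p)%:E)%E.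
Proof.
move=> p0 /andP[a0 ab].
have D (x : R) : 0 < x -> is_derive x 1 (fun y => p^-1 * y `^ p) (x `^ (p - 1)).
  move=> x0; have := @is_deriveZ _ _ _ _ p^-1 x 1 _ (is_derive1_powR p x0).
  by move=> H; apply: (is_derive_eq H); rewrite /GRing.scale/= mulKf.
rewrite (@continuous_FTC2 _ _ (fun y => p^-1 * y `^ p)) //.
- by rewrite -EFinB; congr (_%:E); ring.
- apply: continuous_in_subspaceT => x; rewrite inE/= in_itv/= => /andP[ax _].
  exact: powR_continuous_at (lt_le_trans a0 ax).
- split=> [x||].
  + by rewrite in_itv/= => /andP[ax _]; have [] := D x (lt_trans a0 ax).
  + apply: cvg_at_right_filter; exact: is_derive_continuous (D a a0).
  + apply: cvg_at_left_filter.
    exact: is_derive_continuous (D b (lt_trans a0 ab)).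
- move=> x; rewrite in_itv/= => /andP[ax _]; rewrite derive1E.
  by have [] := D x (lt_trans a0 ax).
Qed.

(** Monotone convergence along the intervals [e / (n + 2), e], on which the
    integral is (e^p - (e / (n + 2))^p) / p, bounded by e^p / p. *)
Lemma integrable_powR0 (p e : R) : 0 < p -> 0 < e ->
  mu.-integrable `[0, e] (EFin \o (fun x => x `^ (p - 1))).
Proof.
move=> p0 e0.
have mp D : measurable D -> measurable_fun D (fun x : R => (x `^ (p - 1))%:E).
  move=> mD; apply/measurable_EFinP; apply: measurable_funS (measurable_powR _) => //.
apply/integrableP; split; first exact: mp.
pose F (n : nat) : set R := `[e / n.+2%:R, e]%classic.
have UF : \bigcup_n F n = `]0, e].
  apply/seteqP; split => [x [n _]|x]; rewrite /F /= !in_itv/=.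
    by move=> /andP[nx ->]; rewrite andbT (lt_le_trans _ nx)// divr_gt0.
  move=> /andP[x0 xe]; exists (Num.truncn (e / x)) => //.
  rewrite /F /= in_itv/= xe andbT ler_pdivrMr// -ler_pdivrMl// mulrC.
  by apply/ltW/(lt_trans (truncnS_gt _)); rewrite ltr_nat.
under eq_integral do rewrite gee0_abs ?lee_fin ?powR_ge0//.
rewrite -integral_itv_obnd_cbnd//; last exact: mp.
rewrite -UF.
have ndF : nondecreasing_seq F.
  move=> n m nm; apply/subsetPset => x; rewrite /F /= !in_itv/= => /andP[nx ->].
  rewrite andbT (le_trans _ nx)// ler_pM2l// lef_pV2 ?posrE// ler_nat//.
have cv := @ge0_nondecreasing_set_cvg_integral _ (measurableTypeR R) R F
  (fun x => (x `^ (p - 1))%:E) mu ndF (fun=> measurable_itv _)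
  (fun i => mp _ (measurable_itv _)) (fun i x _ => powR_ge0 _ _).
apply: (@le_lt_trans _ _ (e `^ p / p)%:E); last exact: ltry.
rewrite -(cvg_lim _ cv)//; apply: lime_le; first by apply/cvg_ex; eexists; exact: cv.
near=> n; rewrite Rintegral_powR ?gt_eqF//.
  by rewrite lee_fin ler_pM2r ?invr_gt0// gerBl powR_ge0.
by rewrite divr_gt0//= ltr_pdivrMr// ltr_pMr// ltr1n.
Unshelve. all: by end_near. Qed.

End integrals.

(** * Differentiation under the integral sign: the near part *)

Section under.
Context {R : realType}.
Notation mu := (@lebesgue_measure R).

Lemma is_derive_under_integral (B : set R) (f f' : R -> R -> R) (G : R -> R) a u v :
  measurable B -> u < a < v ->
  (forall x, u < x < v -> mu.-integrable B (EFin \o f x)) ->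
  (forall x y, u < x < v -> B y -> is_derive x 1 (f^~ y) (f' x y)) ->
  mu.-integrable B (EFin \o G) ->
  (forall x y, u < x < v -> B y -> `|f' x y| <= G y) ->
  is_derive a 1 (fun x => \int[mu]_(y in B) f x y) (\int[mu]_(y in B) f' a y).
Proof.
move=> mB auv fi fD Gi fG.
have auv' : `]u, v[ a by rewrite /= in_itv.
have fi' x : `]u, v[ x -> mu.-integrable B (EFin \o f x).
  by rewrite /= in_itv; exact: fi.
have fD' x y : `]u, v[ x -> B y -> derivable (f^~ y) x 1.
  by rewrite /= in_itv => xuv By; have [] := fD _ _ xuv By.
have fE x y : u < x < v -> B y -> partial1of2 f x y = f' x y.
  by move=> xuv By; rewrite /partial1of2 derive1E; have [] := fD _ _ xuv By.
have Gi' : mu.-integrable B (EFin \o (fun y => `|G y|)) by exact: integrable_norm.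
have fG' x y : `]u, v[ x -> B y -> `|partial1of2 f x y| <= `|G y|.
  rewrite /= in_itv => xuv By; rewrite fE//.
  exact: le_trans (fG _ _ xuv By) (ler_norm _).
apply: DeriveDef.
  exact: (@derivable_under_integral R _ (measurableTypeR R) mu f B mB _ _ _ auv'
    fi' fD' _ (fun=> normr_ge0 _) Gi' fG').
rewrite -derive1E (@differentiation_under_integral R _ (measurableTypeR R) mu f
  B mB _ _ _ auv' fi' fD' _ (fun=> normr_ge0 _) Gi' fG').
by apply: eq_Rintegral => y; rewrite inE => By; rewrite fE.
Qed.

Lemma continuous_bounded_itv (f : R -> R) (a b : R) :
  (forall x, a <= x <= b -> {for x, continuous f}) ->
  exists M, forall x, a <= x <= b -> `|f x| <= M.
Proof.
move=> fc.
have cf : {within `[a, b], continuous f}.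
  by apply: continuous_in_subspaceT => x; rewrite inE/= in_itv/=; exact: fc.
have /compact_bounded[M [_ HM]] := continuous_compact cf (@segment_compact R a b).
exists (M + 1) => x xab; apply: (HM (M + 1)); first by rewrite ltrDl.
by exists x => //=; rewrite in_itv.
Qed.

Lemma measurable_fun_continuous_itv (f : R -> R) (a b : R) :
  (forall x, a <= x <= b -> {for x, continuous f}) -> measurable_fun `[a, b] f.
Proof.
move=> fc; apply: subspace_continuous_measurable_fun => //.
by apply: continuous_in_subspaceT => x; rewrite inE/= in_itv/=; exact: fc.
Qed.

Lemma continuous_reflect (w : R -> R) c x :
  {for c - x, continuous w} -> {for x, continuous (fun y => w (c - y))}.
Proof.
move=> wc; apply: continuous_comp => //.
by apply: continuousB => //; exact: cst_continuous.
Qed.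

Lemma dist_reflect_lt (t d e s x : R) : 2 * e < d -> `|s - t| < e -> 0 <= x <= e ->
  `|s - x - t| < d.
Proof. by rewrite !ltr_norml => ed /andP[s1 s2] /andP[x1 x2]; apply/andP; split; lra. Qed.

Lemma integrable_singular_conv (w : R -> R) (p t d e s : R) : 0 < p -> 0 < e ->
  2 * e < d -> (forall s, `|s - t| < d -> {for s, continuous w}) ->
  `|s - t| < e ->
  mu.-integrable `[0, e] (EFin \o (fun x => x `^ (p - 1) * w (s - x))).
Proof.
move=> p0 e0 ed wc st.
have wc' x : 0 <= x <= e -> {for x, continuous (fun y => w (s - y))}.
  by move=> xe; apply: continuous_reflect; apply: wc; exact: dist_reflect_lt xe.
have [M HM] := continuous_bounded_itv wc'.
have := @integrable_mul_bounded _ `[0, e] (fun x => x `^ (p - 1)) (fun x => w (s - x)) M.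
rewrite (_ : (fun x => w _ * _) = (fun x => x `^ (p - 1) * w (s - x))); last first.
  by apply/funext => x; rewrite mulrC.
apply => //.
- exact: measurable_fun_continuous_itv.
- exact: integrable_powR0.
Qed.

(** The integration variable is the distance x to the singular point, so s occurs
    only in the smooth factor; the derivative is dominated by a multiple of
    x^(p - 1), with a bound of w' on [t - 2e, t + 2e]. *)
Lemma is_derive_singular_conv (w w' : R -> R) (p t d e s0 : R) : 0 < p -> 0 < e ->
  2 * e < d ->
  (forall s, `|s - t| < d -> is_derive s 1 w (w' s)) ->
  (forall s, `|s - t| < d -> {for s, continuous w'}) ->
  `|s0 - t| < e ->
  is_derive s0 1 (fun s => \int[mu]_(x in `[0, e]) (x `^ (p - 1) * w (s - x)))
    (\int[mu]_(x in `[0, e]) (x `^ (p - 1) * w' (s0 - x))).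
Proof.
move=> p0 e0 ed wD wc s0t.
have wc0 s : `|s - t| < d -> {for s, continuous w}.
  by move=> /wD /is_derive_continuous.
have [M HM] : exists M, forall x, t - 2 * e <= x <= t + 2 * e -> `|w' x| <= M.
  apply: continuous_bounded_itv => x xt; apply: wc.
  by rewrite ltr_norml; lra.
have es (s : R) : t - e < s < t + e -> `|s - t| < e by rewrite ltr_norml; lra.
apply: (@is_derive_under_integral _ (fun s x => x `^ (p - 1) * w (s - x))
  (fun s x => x `^ (p - 1) * w' (s - x)) (fun x => M * x `^ (p - 1)) _ (t - e) (t + e)).
- exact: measurable_itv.
- by move: s0t; rewrite ltr_norml; lra.
- move=> s /es st; exact: integrable_singular_conv wc0 st.
- move=> s x /es st; rewrite /= in_itv/= => xe.
  have wsx := wD _ (dist_reflect_lt ed st xe).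
  have H := @is_derive1_comp _ w _ s _ _ wsx (is_derive_subl s x).
  have := @is_deriveZ _ _ _ _ (x `^ (p - 1)) s 1 _ H.
  by move=> H'; apply: (is_derive_eq H'); rewrite /GRing.scale/= mulr1.
- apply: (@integrable_mul_bounded _ _ _ (cst M) `|M|) => //.
  exact: integrable_powR0.
- move=> s x /es; rewrite ltr_norml => st; rewrite /= in_itv/= => xe.
  rewrite normrM (ger0_norm (powR_ge0 _ _)) mulrC ler_wpM2r ?powR_ge0//.
  by apply: HM; lra.
Qed.

End under.

(** * Leibniz's rule: the far part *)

Section leibniz.
Context {R : realType}.
Notation mu := (@lebesgue_measure R).

Lemma MVT_around (f f' : R -> R) (b0 eta h : R) :
  (forall b, `|b - b0| < eta -> is_derive b 1 f (f' b)) -> `|h| < eta ->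
  exists2 c, `|c - b0| < eta & f (b0 + h) - f b0 = f' c * h.
Proof.
move=> fD heta.
have inD a b x : `|a - b0| < eta -> `|b - b0| < eta -> a <= x <= b -> `|x - b0| < eta.
  by rewrite !ltr_norml; lra.
have h1 : `|b0 + h - b0| < eta by rewrite addrAC subrr add0r.
have h0 : `|b0 - b0| < eta by rewrite subrr normr0 (le_lt_trans _ heta).
have mvt a b : `|a - b0| < eta -> `|b - b0| < eta -> a <= b ->
    exists2 c, `|c - b0| < eta & f b - f a = f' c * (b - a).
  move=> ah bh ab; have [x||c] := @MVT_segment _ f f' a b ab.
  - by rewrite in_itv/= => /andP[ax xb]; apply/fD/(inD a b) => //; rewrite !ltW.
  - apply: derivable_within_continuous => x; rewrite in_itv/= => xab.
    by have [] := fD _ (inD _ _ _ ah bh xab).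
  - by rewrite in_itv/= => /(inD _ _ _ ah bh) ceta ->; exists c.
have [h0'|h0'] := leP 0 h.
  have [|c ceta ->] := mvt _ _ h0 h1; first by rewrite lerDl.
  by exists c => //; rewrite addrAC subrr add0r.
have [|c ceta fc] := mvt _ _ h1 h0; first by rewrite gerDl ltW.
exists c => //; rewrite -[LHS]opprB fc opprD addrA subrr add0r mulrN opprK//.
Qed.

(** The increment splits as a change of s at the fixed bound s0 - e, with
    derivative D, plus a change of the bound at the nearby parameter s.  The mean
    value theorem in the second variable writes the latter as g(s, c) (s - s0) with
    c close to s0 - e, and g is continuous at (s0, s0 - e). *)
Lemma is_derive_moving_bound (W g : R -> R -> R) (D s0 e : R) :
  is_derive s0 1 (W^~ (s0 - e)) D ->
  (\forall x \near (s0, s0 - e), is_derive (x.2 : R) 1 (W x.1) (g x.1 x.2)) ->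
  g x.1 x.2 @[x --> (s0, s0 - e)] --> g s0 (s0 - e) ->
  is_derive s0 1 (fun s => W s (s - e)) (D + g s0 (s0 - e)).
Proof.
move=> WD gD gc.
set b0 := s0 - e.
pose E s := W s (s - e) - W s b0.
suff ED : is_derive s0 1 E (g s0 b0).
  rewrite (_ : (fun s => _) = (W^~ b0) + E); first exact: is_deriveD.
  by apply/funext => s; rewrite /E /= [RHS]addrC subrK.
suff EC : h^-1 *: (E (h *: 1 + s0) - E s0) @[h --> 0^'] --> g s0 b0.
  by apply: DeriveDef; [apply/cvg_ex; exists (g s0 b0)|exact/cvg_lim].
apply/cvgrPdist_le => eps eps0.
have /cvgrPdist_le/(_ _ eps0) gce := gc.
have [/= eta eta0 H] : exists2 eta : R, 0 < eta & forall s b,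
    `|s - s0| < eta -> `|b - b0| < eta ->
    is_derive b 1 (W s) (g s b) /\ `|g s0 b0 - g s b| <= eps.
  have H0 : \forall x \near (s0, s0 - e),
      is_derive (x.2 : R) 1 (W x.1) (g x.1 x.2) /\ `|g s0 b0 - g x.1 x.2| <= eps.
    exact: filterI gD gce.
  have [eta /= eta0 H] := (nbhs_ballP _ _).1 H0.
  exists eta => // s b ss bb; apply: (H (s, b)).
  by split; rewrite /ball /= distrC.
near=> h.
have h0 : h != 0 by near: h; exact: nbhs_dnbhs_neq.
have heta : `|h| < eta by near: h; exact: dnbhs0_lt.
have hs : `|h + s0 - s0| < eta by rewrite addrK.
have [c ceta] := MVT_around (fun b bb => proj1 (H _ b hs bb)) heta.
have -> : E (h *: 1 + s0) = W (h + s0) (b0 + h) - W (h + s0) b0.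
  by rewrite /E [h *: 1]mulr1 /b0; congr (W _ _ - _); ring.
have -> : E s0 = 0 by rewrite /E subrr.
move=> ->; rewrite subr0 /GRing.scale/= mulrCA mulVf// mulr1.
exact: (H _ _ hs ceta).2.
Unshelve. all: by end_near. Qed.

Lemma powR_le_bound (p a b x : R) : 0 < a -> a <= x <= b ->
  x `^ p <= a `^ p + b `^ p.
Proof.
move=> a0 /andP[ax xb].
have x0 : 0 < x := lt_le_trans a0 ax.
have b0 : 0 < b := lt_le_trans x0 xb.
have [p0|p0] := leP 0 p.
  apply: (@le_trans _ _ (b `^ p)); last by rewrite lerDr powR_ge0.
  by rewrite ge0_ler_powR// nnegrE ltW.
apply: (@le_trans _ _ (a `^ p)); last by rewrite lerDl powR_ge0.
rewrite -(opprK p) !(powRN _ (- p)) lef_pV2 ?posrE ?powR_gt0//.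
have np : 0 <= - p by rewrite oppr_ge0 ltW.
by rewrite ge0_ler_powR// nnegrE ltW.
Qed.

Lemma integrable_kernel (v : R -> R) (p a b s : R) : b < s ->
  mu.-integrable `[a, b] (EFin \o v) ->
  mu.-integrable `[a, b] (EFin \o (fun r => (s - r) `^ p * v r)).
Proof.
move=> bs; apply: (@integrable_mul_bounded _ _ _ _ ((s - b) `^ p + (s - a) `^ p)) => //.
  apply: (@measurableT_comp _ _ _ _ _ _ (@powR R ^~ p)) => //.
  by apply: measurable_funB.
move=> r; rewrite /= in_itv/= => /andP[ar rb].
rewrite ger0_norm ?powR_ge0//; apply: powR_le_bound; lra.
Qed.

(** For r <= s - e the kernel (s - r)^p is smooth and bounded, so integrability of
    v is enough to differentiate in s; the moving bound stays in the region where v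
    is continuous, where the fundamental theorem of calculus applies. *)
Lemma is_derive_truncated_conv (v : R -> R) (p t d e s0 : R) : 0 < e ->
  3 * e < d -> 3 * e < t ->
  mu.-integrable `[0, t] (EFin \o v) ->
  (forall s, `|s - t| < d -> {for s, continuous v}) ->
  `|s0 - t| < e ->
  is_derive s0 1 (fun s => \int[mu]_(r in `[0, s - e]) ((s - r) `^ p * v r))
    (p * (\int[mu]_(r in `[0, s0 - e]) ((s0 - r) `^ (p - 1) * v r))
     + e `^ p * v (s0 - e)).
Proof.
move=> e0 ed et vi vc s0t.
have s0t' : - e < s0 - t < e by rewrite -ltr_norml.
pose W (s b : R) := \int[mu]_(r in `[0, b]) ((s - r) `^ p * v r).
pose g (s b : R) := (s - b) `^ p * v b.
have vib b : b <= t -> mu.-integrable `[0, b] (EFin \o v).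
  move=> bt; apply: integrableS vi => //; apply: subset_itvl; by rewrite bnd_simp.
rewrite (_ : e `^ p * v _ = g s0 (s0 - e)); last by rewrite /g; congr (_ `^ _ * _); ring.
apply: (@is_derive_moving_bound W g).
- pose K := `|p| * ((e / 2) `^ (p - 1) + (t + 2 * e) `^ (p - 1)).
  rewrite -RintegralZl//; last by apply: integrable_kernel; [lra|apply: vib; lra].
  apply: (@is_derive_under_integral _ _ (fun s r => (s - r) `^ p * v r)
    (fun s r => p * ((s - r) `^ (p - 1) * v r))
    (fun r => K * `|v r|)
    s0 (s0 - e / 2) (s0 + e / 2)).
  + exact: measurable_itv.
  + lra.
  + by move=> s ss0; apply: integrable_kernel; [lra|apply: vib; lra].
  + move=> s r ss0; rewrite /= in_itv/= => rs0.
    have sr0 : 0 < s - r by lra.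
    have H := @is_derive1_comp _ (@powR R ^~ p) _ s _ _ (is_derive1_powR p sr0)
      (is_derive_subl s r).
    have := @is_deriveZ _ _ _ _ (v r) s 1 _ H => H'.
    rewrite (_ : (fun s => _) = v r *: ((@powR R ^~ p) \o (fun s => s - r)));
      last first.
      by apply/funext => y; rewrite /= mulrC.
    by apply: (is_derive_eq H'); rewrite /GRing.scale/=; ring.
  + apply: (@integrable_mul_bounded _ _ (fun r => `|v r|) (cst K) `|K|) => //.
    have vi0 : mu.-integrable `[0, s0 - e] (EFin \o v) by apply: vib; lra.
    exact: integrable_norm vi0.
  + move=> s r ss0; rewrite /= in_itv/= => rs0.
    rewrite !normrM mulrA ler_wpM2r// ler_wpM2l//.
    by rewrite ger0_norm ?powR_ge0// powR_le_bound//; lra.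
(* This eta keeps b positive, below s and below t when |s - s0| and
   |b - (s0 - e)| are less than eta; the interval extends to s0 - e + 2 * eta
   because the fundamental theorem of calculus needs room to the right of b. *)
- pose eta := Num.min (e / 4) ((t - (s0 - e)) / 2).
  have eta0 : 0 < eta by rewrite lt_min !divr_gt0//; lra.
  have [ee et'] : eta <= e / 4 /\ eta <= (t - (s0 - e)) / 2.
    by rewrite /eta !ge_min !lexx orbT.
  apply/nbhs_ballP; exists eta => //= -[s b] [/=].
  rewrite /ball/= => ss bb.
  have {}ss : - eta < s0 - s < eta by rewrite -ltr_norml.
  have {}bb : - eta < s0 - e - b < eta by rewrite -ltr_norml.
  have bpos : 0 < b by lra.
  have sb : 0 < s - b by lra.
  have bu : b < s0 - e + 2 * eta by lra.
  have [||fd fE] := @continuous_FTC1_closed _ (fun r => (s - r) `^ p * v r) 0 b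
    (s0 - e + 2 * eta) bu _ bpos.
  + by apply: integrable_kernel; [lra|apply: vib; lra].
  + apply: continuousM.
      apply: (@continuous_comp _ _ _ (fun r => s - r) (@powR R ^~ p)).
        exact: is_derive_continuous (is_derive_subr s b).
      exact: powR_continuous_at.
    by apply: vc; rewrite ltr_norml; lra.
  + by apply: DeriveDef => //; rewrite -derive1E fE.
- have sv : v (x.2) @[x --> (s0, s0 - e)] --> v (s0 - e).
    apply: continuous_cvg; last exact: cvg_snd.
    by apply: vc; rewrite ltr_norml; lra.
  apply: cvgM => //.
  apply: (@continuous_cvg _ _ _ _ _ (fun x : R * R => x.1 - x.2) (@powR R ^~ p)).
    by apply: powR_continuous_at; lra.
  by apply: cvgB; [exact: cvg_fst|exact: cvg_snd].
Qed.

End leibniz.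

(** * Finite parts: uniqueness and expansion in powers *)

Section finite_parts.
Context {R : realType}.
Notation mu := (@lebesgue_measure R).

Lemma cvg_half_right0 (f : R -> R) (l : R) :
  f e @[e --> 0^'+] --> l -> f (e / 2) @[e --> 0^'+] --> l.
Proof.
move=> fl; apply: cvg_comp fl => P /=.
move=> [d /= d0 dP]; exists d => //= e; rewrite /ball/= sub0r normrN => ed e0.
apply: dP; last by rewrite divr_gt0.
rewrite /ball/= sub0r normrN gtr0_norm ?divr_gt0//; move: ed.
by rewrite gtr0_norm//; lra.
Qed.

Lemma cvg_right0_unique (f : R -> R) (l l' : R) :
  f e @[e --> 0^'+] --> l -> f e @[e --> 0^'+] --> l' -> l = l'.
Proof. by move=> fl fl'; rewrite -(cvg_lim _ fl)// -(cvg_lim _ fl'). Qed.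

Lemma cvg_right0_near_eq (f g : R -> R) (d l : R) : 0 < d ->
  (forall e, 0 < e < d -> f e = g e) ->
  f e @[e --> 0^'+] --> l -> g e @[e --> 0^'+] --> l.
Proof.
move=> d0 fg; apply: cvg_trans; apply: near_eq_cvg.
near=> e; apply: fg; apply/andP; split=> //.
Unshelve. all: by end_near. Qed.

Lemma cvg_right0_eq (f g : R -> R) (l : R) : (forall e, 0 < e -> f e = g e) ->
  f e @[e --> 0^'+] --> l -> g e @[e --> 0^'+] --> l.
Proof.
by move=> fg; apply: (@cvg_right0_near_eq _ _ 1) => // e /andP[e0 _]; exact: fg.
Qed.

Lemma cvg_halving (f : R -> R) (q : R) : f e @[e --> 0^'+] --> 0 ->
  f (e / 2) - q * f e @[e --> 0^'+] --> 0.
Proof.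
move=> f0; have : f (e / 2) - q * f e @[e --> 0^'+] --> 0 - q * 0.
  by apply: cvgB; [exact: (@cvg_half_right0 f)|exact: cvgMl_tmp].
by rewrite mulr0 subr0.
Qed.

Lemma powR_half (e l : R) : 0 < e -> (e / 2) `^ (- l) = 2 `^ l * e `^ (- l).
Proof.
move=> e0; rewrite powRM ?invr_ge0 ?ltW// mulrC; congr (_ * _).
by rewrite -powR_inv1// -powRrM mulN1r opprK.
Qed.

Lemma ln_inv_half (e : R) : 0 < e -> ln (1 / (e / 2)) = ln (1 / e) + ln 2.
Proof.
move=> e0; rewrite -lnM ?posrE ?divr_gt0//; congr ln.
by field; rewrite gt_eqF.
Qed.

(** Induction on the number of powers.  Replacing phi(e) by
    phi(e / 2) - 2^l phi(e) preserves convergence to 0 and kills the power of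
    exponent - l, while b and d become b (1 - 2^l) and d (1 - 2^l) + b ln 2.  Since
    2^l <> 1, the new pair vanishes only if b = d = 0.  The exponents may be
    repeated, so nothing can be said about the single coefficients a k. *)
Lemma powR_log_sum_cvg0 (N : nat) (a l : 'I_N -> R) (b d : R) :
  (forall k, 0 < l k) ->
  \sum_(k < N) a k * e `^ (- l k) + b * ln (1 / e) + d @[e --> 0^'+] --> 0 ->
  b = 0 /\ d = 0.
Proof.
elim: N a l b d => [|N IH] a l b d l0 cv.
  have bln2 : b * ln 2 = 0.
    apply: (@cvg_right0_unique (fun=> b * ln 2)); first exact: cvg_cst.
    apply: cvg_right0_eq (cvg_halving 1 cv) => e e0.
    by rewrite /= !big_ord0 ln_inv_half//; ring.
  have ln2 : 0 < ln (2 : R) by rewrite ln_gt0// ltr1n.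
  have b0 : b = 0.
    by move/eqP : bln2; rewrite mulf_eq0 (gt_eqF ln2) orbF => /eqP.
  split => //; apply: (@cvg_right0_unique (fun=> d)); first exact: cvg_cst.
  apply: cvg_right0_eq cv => e e0.
  by rewrite /= big_ord0 b0 mul0r !add0r.
pose q : R := 2 `^ l ord_max.
have q1 : 1 - q != 0.
  rewrite subr_eq0 eq_sym powR_eq1 !negb_or; apply/and3P; split.
  - by rewrite gt_eqF// ltr1n.
  - by rewrite -leNgt.
  - by rewrite gt_eqF.
pose w := @widen_ord N N.+1 (leqnSn N).
have [|b0 d0] := IH (fun k => a (w k) * (2 `^ l (w k) - q)) (l \o w)
    (b * (1 - q)) (d * (1 - q) + b * ln 2) (fun k => l0 (w k)).
  apply: cvg_right0_eq (cvg_halving q cv) => e e0.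
  (* The last power cancels, because q is 2 to the last exponent. *)
  have -> : \sum_(k < N) a (w k) * (2 `^ l (w k) - q) * e `^ (- (l \o w) k) =
      \sum_(k < N.+1) a k * (e / 2) `^ (- l k) - q * \sum_(k < N.+1) a k * e `^ (- l k).
    rewrite mulr_sumr -sumrB big_ord_recr /= powR_half// -/q.
    rewrite [X in _ = _ + X](_ : _ = 0); last by ring.
    rewrite addr0; apply: eq_bigr => k _; rewrite -/w powR_half//; ring.
  by rewrite ln_inv_half//; ring.
have {}b0 : b = 0.
  by move/eqP : b0; rewrite mulf_eq0 (negbTE q1) orbF => /eqP.
split => //; move/eqP : d0; rewrite b0 mul0r addr0.
by rewrite mulf_eq0 (negbTE q1) orbF => /eqP.
Qed.

Lemma is_finite_part_unique (f : R -> R) (A l l' : R) : 0 < A ->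
  is_finite_part f A l -> is_finite_part f A l' -> l = l'.
Proof.
move=> A0 [_ [N [a [la [b [J [la0 HJ Jl]]]]]]].
move=> [_ [N' [a' [la' [b' [J' [la0' HJ' Jl']]]]]]].
pose c k := match fintype.split k with inl i => a i | inr j => - a' j end.
pose lc k := match fintype.split k with inl i => la i | inr j => la' j end.
suff [_ /eqP] : b - b' = 0 /\ l - l' = 0 by rewrite subr_eq0 => /eqP.
apply: (@powR_log_sum_cvg0 (N + N') c lc) => [k|].
  by rewrite /lc; case: (fintype.split k).
have cJ : (J' e - J e) + (l - l') @[e --> 0^'+] --> (l' - l) + (l - l').
  by apply: cvgD; [exact: cvgB|exact: cvg_cst].
rewrite (_ : _ + (l - l') = 0) in cJ; last by ring.
apply: cvg_right0_near_eq A0 _ cJ => e eA; rewrite big_split_ord/=.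
have E1 : \sum_(i < N) c (lshift N' i) * e `^ (- lc (lshift N' i)) =
    \sum_(i < N) a i * e `^ (- la i).
  apply: eq_bigr => i _.
  by rewrite /c /lc -/(unsplit (inl i)) unsplitK.
have E2 : \sum_(i < N') c (rshift N i) * e `^ (- lc (rshift N i)) =
    - \sum_(i < N') a' i * e `^ (- la' i).
  rewrite -sumrN; apply: eq_bigr => i _.
  by rewrite /c /lc -/(unsplit (inr i)) unsplitK mulNr.
rewrite E1 E2; have := HJ e eA; rewrite (HJ' e eA); lra.
Qed.

(** The Taylor polynomial of degree k contributes the exponents p - (k + 1) + j,
    j <= k, which are all negative, and the remainder is O(e^p).  The sum is padded
    up to n so that all k < n share the exponents p - 1, ..., p - n. *)
Lemma tower_powR_expansion (n k : nat) (g : nat -> R -> R) (t d p : R) :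
  0 < d -> 0 < p -> (k < n)%N ->
  derivative_tower k.+1 g t d -> {for t, continuous (g k.+1)} ->
  exists a : nat -> R, e `^ (p - k.+1%:R) * g 0 (t - e) -
     \sum_(i < n) a i * e `^ (- (i.+1%:R - p)) @[e --> 0^'+] --> 0.
Proof.
move=> d0 p0 kn gT gc.
have [a [C [e0 [C0 e00 H]]]] := taylor_left d0 gT gc.
exists (fun i => if (i < k.+1)%N then a (k - i)%N else 0).
have Cp : C * e `^ p @[e --> 0^'+] --> 0.
  have : C * e `^ p @[e --> 0^'+] --> C * 0 by apply: cvgMl_tmp; exact: powR_cvg0.
  by rewrite mulr0.
apply/cvgrPdist_le => eps eps0.
have /cvgrPdist_le/(_ _ eps0) Ce := Cp.
have ne0 : \forall e \near 0^'+, e < e0 by exact: nbhs_right_lt.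
near=> e.
have e_gt0 : 0 < e by [].
have : `|0 - C * e `^ p| <= eps by near: e; exact: Ce.
rewrite !sub0r !normrN (ger0_norm (mulr_ge0 C0 (powR_ge0 _ _))).
apply: le_trans.
have -> : \sum_(i < n) (if (i < k.+1)%N then a (k - i)%N else 0) *
    e `^ (- (i.+1%:R - p)) = e `^ (p - k.+1%:R) * \sum_(j < k.+1) a j * e ^+ j.
  rewrite mulr_sumr [RHS](reindex_inj rev_ord_inj)/=.
  rewrite (big_ord_widen n (fun i => e `^ (p - k.+1%:R) *
    (a (k - i)%N * e ^+ (k - i))))// [RHS]big_mkcond/=.
  apply: eq_bigr => i _; case: ifPn => ik; last by rewrite mul0r.
  rewrite mulrCA; congr (_ * _).
  rewrite -powR_mulrn ?ltW// -powRD; last by rewrite (gt_eqF e_gt0) implybT.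
  by congr (_ `^ _); rewrite natrB; [rewrite -!natr1; ring|lia].
rewrite -mulrBr normrM (ger0_norm (powR_ge0 _ _)).
apply: (@le_trans _ _ (e `^ (p - k.+1%:R) * (C * e ^+ k.+1))).
  rewrite ler_wpM2l ?powR_ge0//; apply: H; apply/andP; split; first exact: ltW.
  by near: e.
rewrite mulrCA -(powR_mulrn _ (ltW e_gt0)) -powRD; last by rewrite (gt_eqF e_gt0) implybT.
by rewrite subrK.
Unshelve. all: by end_near. Qed.

End finite_parts.

(** * Iterated derivatives of the convolution with a power *)

Section convolution.
Context {R : realType}.
Notation mu := (@lebesgue_measure R).
Implicit Types (p t d e s : R) (v : R -> R) (g : nat -> R -> R).

Definition power_conv p v s :=
  \int[mu]_(r in `[0, s]) ((s - r) `^ (p - 1) * v r).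

Definition near_conv p e v s :=
  \int[mu]_(x in `[0, e]) (x `^ (p - 1) * v (s - x)).

Definition far_conv p e v s :=
  \int[mu]_(r in `[0, s - e]) ((s - r) `^ p * v r).

Lemma integrable_power_conv p t d e s v : 0 < p -> 0 < e -> 3 * e < d -> 3 * e < t ->
  mu.-integrable `[0, t] (EFin \o v) ->
  (forall s, `|s - t| < d -> {for s, continuous v}) -> `|s - t| < e ->
  mu.-integrable `[0, s] (EFin \o (fun r => (s - r) `^ (p - 1) * v r)).
Proof.
move=> p0 e0 ed et vi vc st.
have [st1 st2] : - e < s - t /\ s - t < e by apply/andP; rewrite -ltr_norml.
apply: (@integrable_itv_cat _ 0 (s - e)).
  apply: (@integrable_kernel R v (p - 1) 0 (s - e) s); first lra.
  apply: integrableS vi => //; apply: subset_itvl; rewrite bnd_simp; lra.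
rewrite (_ : (fun r => _) =
    fun y => (fun x => x `^ (p - 1) * v (s - x)) (s - y)); last first.
  by apply/funext => y; rewrite (_ : s - (s - y) = y)//; ring.
apply: (@integrable_reflect R s (s - e) s (fun x => x `^ (p - 1) * v (s - x))).
rewrite subrr (_ : s - (s - e) = e); last by ring.
by apply: (@integrable_singular_conv R v p t d e s) => //; lra.
Qed.

Lemma power_conv_split p t d e s v : 0 < p -> 0 < e -> 3 * e < d -> 3 * e < t ->
  mu.-integrable `[0, t] (EFin \o v) ->
  (forall s, `|s - t| < d -> {for s, continuous v}) -> `|s - t| < e ->
  power_conv p v s = near_conv p e v s + far_conv (p - 1) e v s.
Proof.
move=> p0 e0 ed et vi vc st.
have [st1 st2] : - e < s - t /\ s - t < e by apply/andP; rewrite -ltr_norml.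
have fi := integrable_power_conv p0 e0 ed et vi vc st.
have b1 : (BLeft 0 <= BRight (s - e))%O by rewrite bnd_simp; lra.
have b2 : (BRight (s - e) <= BRight s)%O by rewrite bnd_simp; lra.
have sub1 : mu.-integrable `]s - e, s]
    (EFin \o (fun r => (s - r) `^ (p - 1) * v r)).
  by apply: integrableS fi => //; apply: subset_itvr; rewrite bnd_simp; lra.
have sub2 : mu.-integrable `[s - e, s - 0]
    (EFin \o (fun r => (s - r) `^ (p - 1) * v r)).
  rewrite subr0; apply: integrableS fi => //; apply: subset_itvr.
  by rewrite bnd_simp; lra.
apply/eqP; rewrite -subr_eq; apply/eqP.
rewrite /power_conv /far_conv (Rintegral_itvB fi b1 b2).
rewrite Rintegral_itv_obnd_cbnd//.
have := Rintegral_reflect sub2; rewrite subr0 => ->.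
by apply: eq_Rintegral => x _; rewrite (_ : s - (s - x) = x)//; ring.
Qed.

(** The coefficient of x^(p - 1 - k) in the k-th derivative of x^(p - 1). *)
Definition falling p k : R := \prod_(i < k) (p - i.+1%:R).

(** The k-th derivative of the convolution, cut at distance e.  The sum collects the
    boundary terms: the one created when the kernel is differentiated for the
    (i + 1)-st time is afterwards differentiated k - 1 - i times as a function of
    the bound s - e. *)
Definition conv_tower p e g k s :=
  near_conv p e (g k) s +
  \sum_(i < k) falling p i * e `^ (p - i.+1%:R) * g (k.-1 - i)%N (s - e) +
  falling p k * far_conv (p - k.+1%:R) e (g 0%N) s.

Lemma conv_tower_derivative n p t d e g : 0 < p -> 0 < e -> 3 * e < d -> 3 * e < t ->
  mu.-integrable `[0, t] (EFin \o g 0%N) ->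
  derivative_tower n g t d ->
  (forall k s, (k <= n)%N -> `|s - t| < d -> {for s, continuous (g k)}) ->
  derivative_tower n (conv_tower p e g) t e.
Proof.
move=> p0 e0 ed et gi gT gc k s kn st.
have [st1 st2] : - e < s - t /\ s - t < e by apply/andP; rewrite -ltr_norml.
have nD : is_derive s 1 (near_conv p e (g k)) (near_conv p e (g k.+1) s).
  apply: (@is_derive_singular_conv R _ _ p t d e s) => //; first lra.
  - by move=> x; exact: gT.
  - by move=> x; exact: gc.
have fD := @is_derive_truncated_conv R (g 0%N) (p - k.+1%:R) t d e s e0 ed et gi
  (fun s => @gc 0%N s (leq0n n)) st.
have qE : p - k.+1%:R - 1 = p - k.+2%:R by rewrite -[k.+2%:R]natr1; ring.
rewrite qE in fD.
have sD : is_derive s 1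
    (fun s => \sum_(i < k) falling p i * e `^ (p - i.+1%:R) * g (k.-1 - i)%N (s - e))
    (\sum_(i < k) falling p i * e `^ (p - i.+1%:R) * g (k - i)%N (s - e)).
  rewrite -(sum_ord_fctE (fun (i : 'I_k) s => _ * g (k.-1 - i)%N (s - e))).
  apply: is_derive_sum => i; apply: is_derive_scale.
  have ik := ltn_ord i.
  have gD : is_derive (s - e) 1 (g (k.-1 - i)%N) (g (k - i)%N (s - e)).
    have -> : (k - i = (k.-1 - i).+1)%N by lia.
    apply: gT; first by lia.
    by rewrite ltr_norml; lra.
  have := @is_derive1_comp _ (g (k.-1 - i)%N) _ s _ _ gD (is_derive_subl s e).
  by rewrite mulr1.
have := is_deriveD (is_deriveD nD sD) (is_derive_scale (falling p k) fD).
move=> H; apply: (is_derive_eq H).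
rewrite /conv_tower -!addrA; congr (_ + _).
rewrite big_ord_recr/= subnn -addrA; congr (_ + _).
rewrite [falling p k.+1]/falling big_ord_recr/= -/(falling p k) /far_conv.
ring.
Qed.

Lemma conv_tower0 p t d e g : 0 < p -> 0 < e -> 3 * e < d -> 3 * e < t ->
  mu.-integrable `[0, t] (EFin \o g 0%N) ->
  (forall s, `|s - t| < d -> {for s, continuous (g 0%N)}) ->
  forall s, `|s - t| < e -> power_conv p (g 0%N) s = conv_tower p e g 0 s.
Proof.
move=> p0 e0 ed et gi gc s st; rewrite (power_conv_split p0 e0 ed et gi gc st).
by rewrite /conv_tower big_ord0 addr0 /falling big_ord0 mul1r.
Qed.

Lemma far_conv_reflect p e t v : 0 < e ->
  mu.-integrable `[0, t] (EFin \o v) ->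
  far_conv p e v t = \int[mu]_(x in `[e, t]) (x `^ p * v (t - x)).
Proof.
move=> e0 vi; rewrite /far_conv.
have := @Rintegral_reflect R t e t (fun r => (t - r) `^ p * v r).
rewrite subrr => ->; last first.
  apply: (@integrable_kernel R v p 0 (t - e) t); first by rewrite gtrBl.
  by apply: integrableS vi => //; apply: subset_itvl; rewrite bnd_simp gerBl ltW.
by apply: eq_Rintegral => x _; rewrite opprB addrC subrK.
Qed.

Lemma near_conv_cvg0 p t d v : 0 < p -> 0 < d ->
  (forall s, `|s - t| < d -> {for s, continuous v}) ->
  near_conv p e v t @[e --> 0^'+] --> 0.
Proof.
move=> p0 d0 vc.
have d3 : 0 < d / 3 by rewrite divr_gt0.
have vi := @integrable_singular_conv R v p t d (d / 3) t p0 d3.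
have {}vi := vi ltac:(lra) vc ltac:(by rewrite subrr normr0).
exact: cvg_at_right_filter (parameterized_integral_cvg_left d3 vi).
Qed.

(** The identity of conv_tower_derivative holds at t for every small e with the same
    left-hand side, and all its terms except the far integral have a known
    behaviour as e tends to 0. *)
Lemma power_conv_finite_part n p t d g : 0 < p -> 0 < d -> 0 < t ->
  mu.-integrable `[0, t] (EFin \o g 0%N) ->
  derivative_tower n g t d ->
  (forall k s, (k <= n)%N -> `|s - t| < d -> {for s, continuous (g k)}) ->
  exists a : nat -> R,
  falling p n * \int[mu]_(x in `[e, t]) (x `^ (p - n.+1%:R) * g 0%N (t - x)) -
  \sum_(i < n) a i * e `^ (- (i.+1%:R - p)) @[e --> 0^'+] -->
  (power_conv p (g 0%N))^`(n)%classic t.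
Proof.
move=> p0 d0 t0 gi gT gc.
set G := power_conv p (g 0%N).
have tt : `|t - t| < d by rewrite subrr normr0.
(* A k j is the coefficient of e^(p - 1 - j) in the expansion of
   e^(p - 1 - k) g_(n - 1 - k)(t - e). *)
have /choice[A HA] : forall k : 'I_n, exists a : nat -> R,
    e `^ (p - k.+1%:R) * g (n.-1 - k)%N (t - e) -
     \sum_(i < n) a i * e `^ (- (i.+1%:R - p)) @[e --> 0^'+] --> 0.
  move=> k; have kn := ltn_ord k.
  apply: (@tower_powR_expansion R n k (fun j => g (j + (n.-1 - k))%N) t d p) => //.
  - by move=> j s jk sd; rewrite addSn; apply: gT => //; lia.
  - by apply: gc => //; lia.
exists (fun j => - \sum_(k < n) falling p k * A k j).
have cv : G^`(n)%classic t - near_conv p e (g n) t -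
   \sum_(k < n) falling p k * (e `^ (p - k.+1%:R) * g (n.-1 - k)%N (t - e) -
     \sum_(i < n) A k i * e `^ (- (i.+1%:R - p))) @[e --> 0^'+] -->
   G^`(n)%classic t - 0 - \sum_(k < n) falling p k * 0.
  apply: cvgB.
    apply: cvgB; first exact: cvg_cst.
    by apply: near_conv_cvg0 d0 _ => // s; exact: gc.
  by apply: cvg_big => [|k _]; [exact: add_continuous|apply: cvgMl_tmp; exact: HA].
move: cv; rewrite subr0 big1 ?subr0; last by move=> k _; rewrite mulr0.
pose r := Num.min d t / 4.
have r0 : 0 < r by rewrite divr_gt0// lt_min d0.
have [rd rt] : r <= d / 4 /\ r <= t / 4.
  by rewrite /r !ler_pM2r ?invr_gt0// !ge_min !lexx orbT.
apply: cvg_right0_near_eq r0 _ => e /andP[e0 er].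
have ed : 3 * e < d by lra.
have et : 3 * e < t by lra.
have te : `|t - t| < e by rewrite subrr normr0.
have cT := conv_tower_derivative p0 e0 ed et gi gT gc.
have cT0 := conv_tower0 p0 e0 ed et gi (fun s => @gc 0%N s (leq0n n)).
rewrite (tower_derive1n cT cT0 (leqnn n) te) /conv_tower.
rewrite -(far_conv_reflect _ e0 gi).
under [X in _ - X = _]eq_bigr do rewrite mulrBr.
rewrite sumrB.
under [X in _ = _ - X]eq_bigr do rewrite mulNr mulr_suml.
rewrite sumrN exchange_big /=.
under [X in _ - (_ - X) = _]eq_bigr do rewrite mulr_sumr.
have -> : \sum_(i < n) falling p i * (e `^ (p - i.+1%:R) * g (n.-1 - i)%N (t - e))
  = \sum_(i < n) falling p i * e `^ (p - i.+1%:R) * g (n.-1 - i)%N (t - e).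
  by apply: eq_bigr => i _; rewrite mulrA.
have -> : \sum_(i < n) \sum_(j < n) falling p i * A i j * e `^ (- (j.+1%:R - p)) =
  \sum_(i < n) \sum_(j < n) falling p i * (A i j * e `^ (- (j.+1%:R - p))).
  by apply: eq_bigr => i _; apply: eq_bigr => j _; rewrite mulrA.
ring.
Qed.

End convolution.

(** * Back to the tempered operators *)

Section assembly.
Context {R : realType}.
Notation mu := (@lebesgue_measure R).

(** The continuation to - alpha shifts by trunc alpha + 1, which is m. *)
Lemma Gamma_opp (alpha : R) m : m%:R - 1 < alpha < m%:R -> 0 < alpha ->
  (Gamma (- alpha))^-1 = falling (m%:R - alpha) m * (Gamma (m%:R - alpha))^-1.
Proof.
case: m => [|m] /andP[ma am] alpha0; first by lra.
rewrite {1}/Gamma oppr_gt0 ltNge (ltW alpha0) /= normrN gtr0_norm//.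
rewrite (_ : Num.truncn alpha = m); last first.
  by apply: truncn_def; rewrite am andbT; move: ma; rewrite -natr1 addrK => /ltW.
rewrite /Gamma subr_gt0 am invf_div (addrC (- alpha)); congr (_ / _).
rewrite /falling (reindex_inj rev_ord_inj)/=; apply: eq_bigr => i _.
by rewrite subSS natrB; [rewrite -!natr1; ring|have := ltn_ord i; lia].
Qed.

Lemma falling_neq0 (p : R) m : 0 < p < 1 -> falling p m != 0.
Proof.
move=> /andP[p0 p1]; apply/prodf_neq0 => i _.
by rewrite lt_eqF// subr_lt0 (lt_le_trans p1)// ler1n.
Qed.

Lemma exp_tower_continuous c (g : nat -> R -> R) n s :
  (forall k, (k <= n)%N -> {for s, continuous (g k)}) ->
  {for s, continuous (exp_tower c g n)}.
Proof.
move=> gc; apply: cvgM.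
  exact: is_derive_continuous (is_derive_expM c s).
apply: cvg_big => [|k _]; first exact: add_continuous.
by apply: cvgMl_tmp; apply: gc; exact: leq_ord.
Qed.

Lemma integrable_exp (c a b : R) (u : R -> R) :
  mu.-integrable `[a, b] (EFin \o u) ->
  mu.-integrable `[a, b] (EFin \o (fun x => expR (c * x) * u x)).
Proof.
have ec x : {for x, continuous (fun x => expR (c * x))}.
  exact: is_derive_continuous (is_derive_expM c x).
have [M HM] := @continuous_bounded_itv R _ a b (fun x _ => ec x).
apply: (@integrable_mul_bounded R _ u _ M) => //.
exact: (@measurable_fun_continuous_itv R _ a b (fun x _ => ec x)).
Qed.

Lemma derivative_towerZ n (g : nat -> R -> R) t d c : derivative_tower n g t d ->
  derivative_tower n (fun k s => c * g k s) t d.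
Proof. by move=> gT k s kn sd; apply: is_derive_scale; exact: gT. Qed.

(** The exponential is moved out of the tempered integral, F(s) = e^(- sigma s) G(s)
    / Gamma(p), and back in: applying (d/ds + sigma)^m to F amounts to
    differentiating e^(sigma s) F(s) m times. *)
Lemma tempered_deriv_finite_part (sigma alpha : R) (m : nat) (u : R -> R) (t : R)
    (halpha : 0 < alpha)
    (hm : m%:R - 1 < alpha < m%:R)
    (ht : 0 < t)
    (hint : mu.-integrable `[0, t] (EFin \o u))
    (hreg : Cm_near m u t) :
  derivable_upto m (tempered_int sigma (m%:R - alpha) u) t /\
  exists L,
    is_finite_part (fun x => hypersing_integrand sigma alpha u t (t - x)) t L /\
    tempered_deriv m sigma alpha u t = (Gamma (- alpha))^-1 * L.
Proof.
pose p := m%:R - alpha.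
have p01 : 0 < p < 1 by rewrite /p; lra.
have [p0 p1] := andP p01.
have [d d0 [uT uc]] := Cm_near_tower hreg.
pose v r := expR (sigma * r) * u r.
pose g := exp_tower sigma (fun k => u^`(k)%classic).
have g0 : g 0 = v by apply/funext => s; rewrite /g exp_tower0.
have gT : derivative_tower m g t d by exact: exp_tower_derivative.
have gc k s : (k <= m)%N -> `|s - t| < d -> {for s, continuous (g k)}.
  move=> km sd; apply: exp_tower_continuous => i ik.
  by apply: uc => //; exact: leq_trans km.
have gi : mu.-integrable `[0, t] (EFin \o g 0) by rewrite g0; exact: integrable_exp.
pose G := power_conv p (g 0).
pose e := Num.min d t / 4.
have e0 : 0 < e by rewrite divr_gt0// lt_min d0.
have [rd rt] : e <= d / 4 /\ e <= t / 4.
  by rewrite /e !ler_pM2r ?invr_gt0// !ge_min !lexx orbT.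
have ed : 3 * e < d by lra.
have et : 3 * e < t by lra.
have te : `|t - t| < e by rewrite subrr normr0.
have g0c s : `|s - t| < d -> {for s, continuous (g 0)} by exact: gc.
have GT : derivative_tower m (fun k => G^`(k)%classic) t e.
  apply: tower_derive1n_tower (conv_tower_derivative p0 e0 ed et gi gT gc) _.
  exact: conv_tower0 ed et gi g0c.
pose cG := (Gamma p)^-1.
have cGT := derivative_towerZ cG GT.
set F := tempered_int sigma p u.
have FE s : `|s - t| < e -> F s = expR (- sigma * s) * (cG * G s).
  move=> st; rewrite /F /tempered_int mulrCA; congr (_ * _).
  rewrite /G /power_conv -RintegralZl//; last first.
    exact: integrable_power_conv ed et gi g0c st.
  apply: eq_Rintegral => r _; rewrite g0 /v.
  have -> : - (sigma * (s - r)) = - sigma * s + sigma * r by ring.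
  by rewrite expRD; ring.
have FT : derivative_tower m (fun k => F^`(k)%classic) t e.
  apply: tower_derive1n_tower (exp_tower_derivative (- sigma) cGT) _ => s st.
  by rewrite exp_tower0 FE.
split; first exact: tower_derivable FT.
have key : expR (sigma * t) * tempered_deriv m sigma alpha u t = cG * G^`(m)%classic t.
  rewrite -(tower_derive1n cGT (fun _ _ => erefl) (leqnn m) te).
  rewrite (tower_derive1n (exp_tower_derivative sigma FT) _ (leqnn m) te)//.
  by move=> s st; rewrite exp_tower0/= FE// mulrA -expRD mulNr subrr expR0 mul1r.
have c0 : falling p m != 0 by exact: falling_neq0.
have [a Ha] := power_conv_finite_part p0 d0 ht gi gT gc.
have fE x : hypersing_integrand sigma alpha u t (t - x) =
    expR (- sigma * t) * (x `^ (p - m.+1%:R) * g 0 (t - x)).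
  rewrite /hypersing_integrand g0 /v (_ : t - (t - x) = x); last by ring.
  have -> : - alpha - 1 = p - m.+1%:R by rewrite /p -natr1; ring.
  rewrite mulrCA -mulrA; congr (_ * _); rewrite mulrA -expRD.
  by congr (expR _ * _); ring.
have fi eps : 0 < eps -> mu.-integrable `[eps, t]
    (EFin \o (fun x => x `^ (p - m.+1%:R) * g 0 (t - x))).
  move=> eps0.
  rewrite (_ : (fun x => _) =
    fun x => (fun r => (t - r) `^ (p - m.+1%:R) * g 0 r) (t - x)); last first.
    by apply/funext => x; rewrite /= (_ : t - (t - x) = x)//; ring.
  apply: (@integrable_reflect R t eps t (fun r => (t - r) `^ (p - m.+1%:R) * g 0 r)).
  rewrite subrr; apply: (@integrable_kernel R (g 0)); first by rewrite gtrBl.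
  by apply: integrableS gi => //; apply: subset_itvl; rewrite bnd_simp gerBl ltW.
(* power_conv_finite_part is about c_m times the integral of x^(p - 1 - m) v(t - x);
   the integrand at hand carries the factor e^(- sigma t) instead. *)
pose K := expR (- sigma * t) / falling p m.
exists (K * G^`(m)%classic t); split; last first.
  have -> : tempered_deriv m sigma alpha u t =
      expR (- sigma * t) * (cG * G^`(m)%classic t).
    by rewrite -key mulrA -expRD mulNr addNr expR0 mul1r.
  by rewrite (Gamma_opp hm halpha) -/p -/cG /K; field.
split.
  move=> eps /andP[eps0 _]; rewrite (funext fE).
  apply: (@integrable_mul_bounded R _ _ (cst (expR (- sigma * t)))
    `|expR (- sigma * t)|) => //.
  exact: fi.
exists m, (fun i => K * a i), (fun i => i.+1%:R - p), 0.
exists (fun eps => K * (falling p m * \int[mu]_(x in `[eps, t])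
  (x `^ (p - m.+1%:R) * g 0 (t - x)) - \sum_(i < m) a i * eps `^ (- (i.+1%:R - p)))).
split.
- by move=> i; rewrite subr_gt0 (lt_le_trans p1)// ler1n.
- move=> eps /andP[eps0 _]; rewrite (funext fE) RintegralZl//; last exact: fi.
  under eq_bigr do rewrite -mulrA.
  rewrite -mulr_sumr mul0r addr0 mulrBr [RHS]addrC subrK mulrA; congr (_ * _).
  by rewrite /K divfK.
- exact: cvgMl_tmp.
Qed.

End assembly.

Unset Implicit Arguments.

Theorem lemma2p7 (R : realType) (sigma alpha : R) (m : nat) (u : R -> R) (t : R)
    (hsigma : 0 <= sigma) (halpha : 0 < alpha)
    (hm : m%:R - 1 < alpha <= m%:R)
    (* -alpha is not a pole of Gamma *)
    (hpole : forall n : nat, alpha != n%:R)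
    (ht : 0 < t)
    (hint : lebesgue_measure.-integrable `[0, t] (EFin \o u))
    (hreg : Cm_near m u t) :
  [/\ derivable_upto m (tempered_int sigma (m%:R - alpha) u) t,
      has_Hadamard (fun x => hypersing_integrand sigma alpha u t (t - x)) t
    & tempered_deriv m sigma alpha u t =
      (Gamma (- alpha))^-1 *
      finite_part (fun x => hypersing_integrand sigma alpha u t (t - x)) t].
Proof.
have halpha' : m%:R - 1 < alpha < m%:R.
  by case/andP: hm => -> am; rewrite lt_neqAle hpole am.
have [reg [L [fpL dL]]] := tempered_deriv_finite_part sigma halpha halpha' ht hint hreg.
split => //; first by exists L.
rewrite dL /finite_part; congr (_ * _); apply/esym.
apply: (is_finite_part_unique ht _ fpL).
by apply: xgetPex; exists L.
Qed.
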